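(* Let $m$ be a nonnegative even integer and $p$ a positive odd integer with $0\le m\le p$. Suppose that $f\in\mathcal B$ and $f(z)=z^m\sum_{n=0}^{\infty}a_{np+m}z^{np}$, and let $$E_{f_m}(r)=r^m\Big[\sum_{n=1}^{\infty}(-1)^{np+m}|a_{np+m}|r^{np}+(-1)^m\Big(\frac{1}{1+|a_m|}+\frac{r^{2p}}{1-r^{2p}}\Big)\sum_{n=1}^{\infty}|a_{np+m}|^2r^{2np}\Big].$$ Then $$\Big|\,|f(z)|+E_{f_m}(r)\,\Big|\le1\quad\text{for } |z|=r\le r_{p,m},$$ where $r_{p,m}$ is the minimal positive root of the equation $r^{3p-m}-2r^{3p}-3r^{2p}-r^{p-m}+1=0$.
   Context: $\mathbb D=\{z\in\mathbb C:|z|<1\}$. $\mathcal B$ is the class of analytic functions $f$ on $\mathbb D$ with $|f(z)|<1$ for all $z\in\mathbb D$. *)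

(* Defs.v *)
From Stdlib Require Import Reals Arith.
From Coquelicot Require Import Coquelicot.
Open Scope R_scope.

(* The class B.  Analyticity on the open disc is complex differentiability at
   each of its points; [f] is total, and its values off the disc are
   unconstrained. *)
Definition class_B (f : C -> C) : Prop :=
  forall z : C, Cmod z < 1 -> ex_derive f z /\ Cmod (f z) < 1.

(* f(z) = z^m * sum_{n >= 0} a_{np+m} z^{np} on the disc.  Only the entries of
   [a] at the indices n p + m matter. *)
Definition lacunary_expansion (p m : nat) (a : nat -> C) (f : C -> C) : Prop :=
  forall z : C, Cmod z < 1 ->
    exists s : C,
      is_series (fun n : nat => (a (n * p + m)%nat * Cpow z (n * p))%C) s /\
      f z = (Cpow z m * s)%C.

(* sum_{n >= 1} u n *)
Definition Series1 (u : nat -> R) : R := Series (fun n : nat => u (S n)).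

Definition E_fm (p m : nat) (a : nat -> C) (r : R) : R :=
  r ^ m *
  (Series1 (fun n : nat =>
     (-1) ^ (n * p + m) * Cmod (a (n * p + m)%nat) * r ^ (n * p))
   + (-1) ^ m *
     (/ (1 + Cmod (a m)) + r ^ (2 * p) / (1 - r ^ (2 * p))) *
     Series1 (fun n : nat =>
       Cmod (a (n * p + m)%nat) ^ 2 * r ^ (2 * n * p))).

(* The truncated subtractions are exact when m <= p. *)
Definition radius_eq (p m : nat) (r : R) : Prop :=
  r ^ (3 * p - m) - 2 * r ^ (3 * p) - 3 * r ^ (2 * p) - r ^ (p - m) + 1 = 0.

Definition is_min_pos_root (P : R -> Prop) (r : R) : Prop :=
  0 < r /\ P r /\ forall s : R, 0 < s -> P s -> r <= s.

(* Main.v *)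
(** Write [x = r^p], [b_n = a_{np+m}], [alpha = |b_0|].  Wiener's inequality
    [|b_n| <= 1 - alpha^2] follows by averaging [f / z^m] against a suitable
    trigonometric square over roots of unity on the circle of radius [R] and
    letting [R] tend to [1].  Since [m] is even and [p] odd, the sign of the
    n-th term is [(-1)^n], so in [sum |b_n| x^n + E] the odd linear terms cancel:
    what remains above [alpha] is at most
    [2 (1 - alpha^2) q + c (1 - alpha^2)^2 q] with [q = x^2 / (1 - x^2)] and
    [c = 1 / (1 + alpha) + q].  Parity also gives [m < p], and up to the
    minimal root the radius equation gives [x^2 + 2 x <= 1], which makes [q] small enough; the triangle inequality for
    [|f|] thus suffices, without Schwarz-Pick or Carlson's inequality. *)
Require Import Defs.
From Stdlib Require Import Reals Arith ZArith Lra Lia.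
From Coquelicot Require Import Coquelicot.
Open Scope R_scope.

(** * Wiener's inequality for trigonometric polynomials *)

Definition cis (t : R) : C := (cos t, sin t).

Lemma cis_add (s t : R) : cis (s + t) = (cis s * cis t)%C.
Proof.
  unfold cis, Cmult; simpl; rewrite cos_plus, sin_plus.
  f_equal; ring.
Qed.

Lemma cis_0 : cis 0 = 1%C.
Proof. unfold cis; rewrite cos_0, sin_0; reflexivity. Qed.

Lemma cis_conj (t : R) : Cconj (cis t) = cis (- t).
Proof. unfold cis, Cconj; simpl; rewrite cos_neg, sin_neg; reflexivity. Qed.

Lemma Cmod_cis (t : R) : Cmod (cis t) = 1.
Proof.
  unfold Cmod, cis; simpl.
  replace (_ + _) with 1 by (generalize (sin2_cos2 t); unfold Rsqr; lra).
  apply sqrt_1.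
Qed.

Lemma Cpow_cis (t : R) (n : nat) : Cpow (cis t) n = cis (INR n * t).
Proof.
  induction n as [|n IH].
  - simpl; rewrite Rmult_0_l, cis_0; reflexivity.
  - rewrite Cpow_S, IH, <- cis_add, S_INR; f_equal; ring.
Qed.

Lemma cis_2PI_mul (j : Z) : cis (IZR j * (2 * PI)) = 1%C.
Proof.
  assert (Hn : forall n, cis (INR n * (2 * PI)) = 1%C).
  { intro n; rewrite <- Cpow_cis.
    replace (cis (2 * PI)) with (RtoC 1); [apply Cpow_1_l|].
    unfold cis; rewrite cos_2PI, sin_2PI; reflexivity. }
  destruct (Z_le_gt_dec 0 j) as [H|H].
  - rewrite <- (Z2Nat.id j H), <- INR_IZR_INZ; apply Hn.
  - replace (IZR j * (2 * PI)) with (- (INR (Z.to_nat (- j)) * (2 * PI))).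
    + rewrite <- cis_conj, Hn; unfold Cconj; simpl; rewrite Ropp_0; reflexivity.
    + rewrite INR_IZR_INZ, Z2Nat.id, opp_IZR by lia; ring.
Qed.

(** Half-open, unlike the inclusive [sum_n]: [L] sample points or [K] coefficients are summed
    without an index shift. *)
Fixpoint Csum (u : nat -> C) (n : nat) : C :=
  match n with
  | O => 0%C
  | S k => (Csum u k + u k)%C
  end.

Lemma sum_n_Csum (u : nat -> C) (n : nat) : sum_n u n = Csum u (S n).
Proof.
  induction n as [|n IH].
  - rewrite sum_O; simpl; ring.
  - rewrite sum_Sn, IH; reflexivity.
Qed.

Lemma Csum_ext (u v : nat -> C) (n : nat) :
  (forall k, (k < n)%nat -> u k = v k) -> Csum u n = Csum v n.
Proof.
  induction n as [|n IH]; intro H; simpl; [reflexivity|].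
  rewrite IH, H; auto with arith.
Qed.

Lemma Csum_plus (u v : nat -> C) (n : nat) :
  Csum (fun k => u k + v k)%C n = (Csum u n + Csum v n)%C.
Proof. induction n as [|n IH]; simpl; [|rewrite IH]; ring. Qed.

Lemma Csum_mult_l (c : C) (u : nat -> C) (n : nat) :
  Csum (fun k => c * u k)%C n = (c * Csum u n)%C.
Proof. induction n as [|n IH]; simpl; [|rewrite IH]; ring. Qed.

Lemma Csum_const (c : C) (n : nat) : Csum (fun _ => c) n = (RtoC (INR n) * c)%C.
Proof.
  induction n as [|n IH]; [simpl; ring|].
  simpl Csum; rewrite IH, S_INR, RtoC_plus; ring.
Qed.

Lemma Csum_switch (u : nat -> nat -> C) (m n : nat) :
  Csum (fun i => Csum (u i) n) m = Csum (fun j => Csum (fun i => u i j) m) n.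
Proof.
  induction m as [|m IH]; simpl.
  - rewrite Csum_const; ring.
  - rewrite IH, Csum_plus; reflexivity.
Qed.

Lemma Csum_single (v : nat -> C) (N K : nat) : (N < K)%nat ->
  (forall n, (n < K)%nat -> n <> N -> v n = 0%C) -> Csum v K = v N.
Proof.
  induction K as [|K IH]; intros HN Hv; [lia|].
  simpl; destruct (Nat.eq_dec N K) as [->|HNK].
  - rewrite (Csum_ext v (fun _ => 0%C)) by (intros; apply Hv; lia).
    rewrite Csum_const; ring.
  - rewrite IH, (Hv K) by (try intros; try apply Hv; lia); ring.
Qed.

(** The majorant is the real part of a complex sum, so that it can itself be evaluated by summing
    over roots of unity. *)
Lemma Cmod_Csum_le (u w : nat -> C) (n : nat) :
  (forall k, Cmod (u k) <= Re (w k)) -> Cmod (Csum u n) <= Re (Csum w n).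
Proof.
  intro H; induction n as [|n IH]; simpl.
  - rewrite Cmod_0; lra.
  - eapply Rle_trans; [apply Cmod_triangle|].
    specialize (H n); unfold Re in *; simpl; lra.
Qed.

Definition root_angle (L k : nat) : R := INR k * (2 * PI / INR L).

(** A geometric sum whose ratio [q] satisfies [q^L = 1] and [q <> 1]. *)
Lemma Csum_roots_of_unity (L : nat) (j : Z) : (j <> 0)%Z -> (Z.abs j < Z.of_nat L)%Z ->
  Csum (fun k => cis (IZR j * root_angle L k)) L = 0%C.
Proof.
  intros Hj HL.
  assert (HL0 : 0 < INR L) by (apply lt_0_INR; lia).
  set (q := cis (IZR j * (2 * PI / INR L))).
  rewrite (Csum_ext _ (fun k => Cpow q k)).
  2:{ intros k _; unfold q, root_angle; rewrite Cpow_cis; f_equal; ring. }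
  assert (Hgeom : forall n, (Csum (fun k => Cpow q k) n * (1 - q) = 1 - Cpow q n)%C).
  { induction n as [|n IH]; [simpl; ring|].
    simpl Csum; rewrite Cpow_S, Cmult_plus_distr_r, IH; ring. }
  assert (Hq : Cpow q L = 1%C).
  { unfold q; rewrite Cpow_cis, <- (cis_2PI_mul j); f_equal; field; lra. }
  (* If [q = 1], the half-angle formula makes the sine of [|j| PI / L] vanish, yet this angle lies
     strictly between 0 and [PI]. *)
  assert (Hq1 : (1 - q <> 0)%C).
  { intro E0.
    assert (E1 : cos (2 * (IZR j * (PI / INR L))) = 1).
    { replace (2 * (IZR j * (PI / INR L))) with (IZR j * (2 * PI / INR L))
        by (field; lra).
      assert (E2 : fst (1 - q)%C = 0) by (rewrite E0; reflexivity).
      unfold q, cis in E2; simpl in E2; lra. }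
    rewrite cos_2a_sin in E1.
    assert (Hs : sin (IZR (Z.abs j) * (PI / INR L)) = 0).
    { assert (S0 : sin (IZR j * (PI / INR L)) = 0) by nra.
      destruct (Z.abs_spec j) as [[_ ->]|[_ ->]]; [exact S0|].
      rewrite opp_IZR, Ropp_mult_distr_l_reverse, sin_neg, S0; ring. }
    assert (Hp : 0 < sin (IZR (Z.abs j) * (PI / INR L))); [|lra].
    assert (Hd : 0 < PI / INR L) by (apply Rdiv_lt_0_compat; [apply PI_RGT_0|lra]).
    assert (Hj0 : 0 < IZR (Z.abs j)) by (apply IZR_lt; lia).
    assert (HjL : IZR (Z.abs j) < INR L) by (rewrite INR_IZR_INZ; apply IZR_lt; lia).
    apply sin_gt_0; [apply Rmult_lt_0_compat; assumption|].
    replace PI with (INR L * (PI / INR L)) at 2 by (field; lra).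
    apply Rmult_lt_compat_r; assumption. }
  specialize (Hgeom L); rewrite Hq in Hgeom.
  replace (Csum (fun k => Cpow q k) L)
    with (Csum (fun k => Cpow q k) L * (1 - q) / (1 - q))%C by (field; exact Hq1).
  rewrite Hgeom; field; exact Hq1.
Qed.

Definition trig_poly (d : nat -> C) (K : nat) (t : R) : C :=
  Csum (fun n => d n * cis (INR n * t))%C K.

(** Discrete Fourier extraction of the coefficient of frequency [-j]. The bound on [L] excludes
    aliasing: every frequency [n + j] with [n < K] is below [L] in absolute value. *)
Lemma Csum_trig_poly (d : nat -> C) (K L : nat) (j : Z) :
  (Z.of_nat K + Z.abs j <= Z.of_nat L)%Z ->
  Csum (fun k => cis (IZR j * root_angle L k) * trig_poly d K (root_angle L k))%C L
  = Csum (fun n => if Z.eqb (Z.of_nat n + j) 0 then RtoC (INR L) * d n else 0)%C K.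
Proof.
  intro HL; unfold trig_poly.
  rewrite (Csum_ext _ (fun k => Csum (fun n => d n *
     cis (IZR (Z.of_nat n + j) * root_angle L k))%C K)).
  2:{ intros k _; rewrite <- Csum_mult_l; apply Csum_ext; intros n _.
      rewrite plus_IZR, <- INR_IZR_INZ, Rmult_plus_distr_r, cis_add; ring. }
  rewrite Csum_switch; apply Csum_ext; intros n Hn.
  rewrite Csum_mult_l.
  destruct (Z.eqb_spec (Z.of_nat n + j) 0) as [E|E].
  - rewrite (Csum_ext _ (fun _ => 1%C)).
    + rewrite Csum_const; ring.
    + intros k _; rewrite E, Rmult_0_l; apply cis_0.
  - rewrite Csum_roots_of_unity by lia; ring.
Qed.

(** The negative sign aligns [tau d_N] with [-2 |d_0|^2], so that the two moduli add up in Wiener's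
    inequality. *)
Lemma unimodular_rotation (c : C) :
  exists tau : C, Cmod tau = 1 /\ (tau * c)%C = RtoC (- Cmod c).
Proof.
  destruct (Ceq_dec c 0) as [->|H].
  - exists 1%C; rewrite Cmod_1, Cmod_0, Ropp_0; split; [reflexivity|ring].
  - assert (Hc := proj1 (Cmod_gt_0 c) H).
    exists (RtoC (- Cmod c) / c)%C; split.
    + rewrite Cmod_div by exact H.
      rewrite Cmod_R, Rabs_Ropp, Rabs_pos_eq by lra; field; lra.
    + field; exact H.
Qed.

(* Test against [tau w^-N (1 - conj tau conj d0 w^N)^2], [w = cis t]: its modulus
   has mean [1 + |d0|^2], and it pairs with the polynomial to
   [tau d_N - 2 |d0|^2]. *)
Lemma trig_poly_wiener (d : nat -> C) (K N : nat) (B : R) :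
  (0 < N < K)%nat -> (forall t, Cmod (trig_poly d K t) <= B) ->
  Cmod (d N) + 2 * Cmod (d O) ^ 2 <= B * (1 + Cmod (d O) ^ 2).
Proof.
  intros HN HB.
  destruct (unimodular_rotation (d N)) as (tau & Ht & HtN).
  (* Enough sample points to separate the frequencies [-N], 0 and [N] from the [K] coefficients. *)
  set (L := (K + N)%nat).
  assert (HL : 0 < INR L) by (apply lt_0_INR; unfold L; lia).
  set (P := fun k => trig_poly d K (root_angle L k)).
  set (e := fun (j : Z) k => cis (IZR j * root_angle L k)).
  set (b := Cconj (d O)).
  set (v := fun k => (1 - Cconj tau * b * e (Z.of_nat N) k)%C).
  assert (Htt : (tau * Cconj tau = 1)%C).
  { rewrite <- Cmod2_conj, Ht; f_equal; ring. }
  assert (Hee : forall k, (e (- Z.of_nat N)%Z k * e (Z.of_nat N) k = 1)%C).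
  { intro k; unfold e; rewrite <- cis_add, <- cis_0; f_equal.
    rewrite opp_IZR; ring. }
  (* The test function expands to [tau w^-N - 2 b + conj tau b^2 w^N]. The first two terms pick out
     [d N] and [d O]; the last would pick out frequency [-N], which is absent. *)
  assert (Hsum : Csum (fun k => P k * (tau * e (- Z.of_nat N)%Z k * (v k * v k)))%C L
    = RtoC (- INR L * (Cmod (d N) + 2 * Cmod (d O) ^ 2))).
  { rewrite (Csum_ext _ (fun k => (tau * (e (- Z.of_nat N)%Z k * P k)
       + (- (2 * b)) * (e 0%Z k * P k))
       + (Cconj tau * b * b) * (e (Z.of_nat N) k * P k))%C).
    2:{ intros k _.
        assert (He0 : e 0%Z k = 1%C) by (unfold e; rewrite Rmult_0_l; apply cis_0).
        rewrite He0; unfold v.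
        transitivity (tau * (e (- Z.of_nat N)%Z k * P k)
          + (- (2 * b)) * ((tau * Cconj tau) * (e (- Z.of_nat N)%Z k * e (Z.of_nat N) k) * P k)
          + (tau * Cconj tau) * (e (- Z.of_nat N)%Z k * e (Z.of_nat N) k)
             * (Cconj tau * b * b * (e (Z.of_nat N) k * P k)))%C; [ring|].
        rewrite Htt, Hee; ring. }
    rewrite !Csum_plus, !Csum_mult_l.
    unfold e, P; rewrite !Csum_trig_poly by (unfold L; lia).
    rewrite (Csum_single _ N K), (Csum_single _ 0 K), (Csum_single _ 0 K); try lia.
    - replace (Z.of_nat N + - Z.of_nat N =? 0)%Z with true by (symmetry; apply Z.eqb_eq; lia).
      replace (Z.of_nat 0 + Z.of_nat N =? 0)%Z with false by (symmetry; apply Z.eqb_neq; lia).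
      replace (Z.of_nat 0 + 0 =? 0)%Z with true by reflexivity.
      transitivity (RtoC (INR L) * (tau * d N - 2 * (d O * b)))%C; [ring|].
      unfold b; rewrite HtN, <- Cmod2_conj.
      rewrite <- !RtoC_mult, <- RtoC_minus, <- RtoC_mult; f_equal; ring.
    - intros n _ Hn; destruct (Z.eqb_spec (Z.of_nat n + Z.of_nat N) 0); [lia|reflexivity].
    - intros n _ Hn; destruct (Z.eqb_spec (Z.of_nat n + 0) 0); [lia|reflexivity].
    - intros n _ Hn; destruct (Z.eqb_spec (Z.of_nat n + - Z.of_nat N) 0); [lia|reflexivity]. }
  (* The summand has real part [B |v|^2], as [Hv] shows below; its oscillating term averages to
     zero. *)
  assert (Hw : Csum (fun k => RtoC B * (RtoC (1 + Cmod (d O) ^ 2)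
       + (- (2 * (Cconj tau * b))) * e (Z.of_nat N) k))%C L
    = RtoC (B * (INR L * (1 + Cmod (d O) ^ 2)))).
  { rewrite Csum_mult_l, Csum_plus, Csum_mult_l, Csum_const.
    unfold e; rewrite Csum_roots_of_unity by (unfold L; lia).
    rewrite !RtoC_mult; ring. }
  assert (HB0 : 0 <= B) by (eapply Rle_trans; [apply Cmod_ge_0|apply (HB 0)]).
  assert (Hv : forall k, Cmod (v k) ^ 2 = Re (RtoC (1 + Cmod (d O) ^ 2)
       + (- (2 * (Cconj tau * b))) * e (Z.of_nat N) k)%C).
  { intro k.
    set (y := (Cconj tau * b * e (Z.of_nat N) k)%C).
    assert (Hy : Cmod y = Cmod (d O)).
    { unfold y, e, b; rewrite !Cmod_mult, !Cmod_conj, Cmod_cis, Ht; ring. }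
    replace (- (2 * (Cconj tau * b)) * e (Z.of_nat N) k)%C with (- (2 * y))%C
      by (unfold y; ring).
    rewrite <- Hy; unfold v; fold y.
    rewrite !Cmod2_alt; unfold Re, Im; destruct y as [y1 y2]; simpl; ring. }
  assert (Hle := Cmod_Csum_le
    (fun k => P k * (tau * e (- Z.of_nat N)%Z k * (v k * v k)))%C
    (fun k => RtoC B * (RtoC (1 + Cmod (d O) ^ 2)
       + (- (2 * (Cconj tau * b))) * e (Z.of_nat N) k))%C L).
  rewrite Hsum, Hw in Hle.
  (* Pointwise, [tau] and [e] are unimodular, so the modulus is [|P| |v|^2], at most [B |v|^2]. *)
  assert (H := Hle (fun k => ltac:(
    rewrite !Cmod_mult, Ht; unfold e at 1; rewrite Cmod_cis;
    rewrite re_scal_l, <- Hv;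
    replace (1 * 1 * (Cmod (v k) * Cmod (v k))) with (Cmod (v k) ^ 2) by ring;
    apply Rmult_le_compat_r; [apply pow2_ge_0|apply HB]))).
  rewrite Cmod_R in H; simpl Re in H.
  replace (- INR L * (Cmod (d N) + 2 * Cmod (d O) ^ 2))
    with (- (INR L * (Cmod (d N) + 2 * Cmod (d O) ^ 2))) in H by ring.
  rewrite Rabs_Ropp, Rabs_pos_eq in H.
  - apply Rmult_le_reg_l with (INR L); [exact HL|]. lra.
  - apply Rmult_le_pos; [lra|]. generalize (Cmod_ge_0 (d N)) (pow2_ge_0 (Cmod (d O))); lra.
Qed.

(** * Coefficient bounds for lacunary series *)

Lemma Cmod_is_series_le (u : nat -> C) (v : nat -> R) (l : C) (T : R) :
  is_series u l -> (forall n, Cmod (u n) <= v n) -> is_series v T -> Cmod l <= T.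
Proof.
  intros Hu Huv Hv.
  refine (is_lim_seq_le (fun n => Cmod (sum_n u n)) (sum_n v) (Cmod l) T _ _ _).
  - intro n; unfold sum_n.
    eapply Rle_trans; [apply (norm_sum_n_m (V := C_NormedModule))|].
    apply sum_n_m_le, Huv.
  - exact (filterlim_comp _ _ _ _ _ _ _ _ Hu (filterlim_norm (V := C_NormedModule) l)).
  - exact Hv.
Qed.

(** Partial sums of a convergent series are bounded, and a term is a difference of two of them. *)
Lemma is_series_terms_bounded (u : nat -> C) (l : C) :
  is_series u l -> exists M, forall n, Cmod (u n) <= M.
Proof.
  intro Hu.
  destruct (filterlim_bounded (V := C_NormedModule) (sum_n u)) as [M HM].
  { exists l; exact Hu. }
  assert (HC : forall n, Cmod (Csum u (S n)) <= M).
  { intro n; rewrite <- sum_n_Csum; apply HM. }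
  exists (M + M); intros [|n].
  - generalize (HC O) (Cmod_ge_0 (u O)); simpl.
    replace (0 + u O)%C with (u O) by ring; lra.
  - replace (u (S n)) with (Csum u (S (S n)) + - Csum u (S n))%C by (simpl; ring).
    eapply Rle_trans; [apply Cmod_triangle|].
    rewrite Cmod_opp; generalize (HC n) (HC (S n)); lra.
Qed.

Lemma Cmod_tail_geom_le (u : nat -> C) (l : C) (M q : R) (K : nat) :
  0 <= q < 1 -> is_series u l -> (forall n, Cmod (u n) <= M * q ^ n) ->
  Cmod (l - Csum u (S K)) <= M * / (1 - q) * q ^ S K.
Proof.
  intros Hq Hu HM.
  apply (Cmod_is_series_le (fun k => u (S K + k)%nat) (fun k => M * q ^ S K * q ^ k)).
  - apply is_series_incr_n; [lia|].
    simpl Nat.pred; rewrite sum_n_Csum.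
    change (is_series u (l - Csum u (S K) + Csum u (S K))%C).
    replace (l - Csum u (S K) + Csum u (S K))%C with l by ring; exact Hu.
  - intro k; rewrite Rmult_assoc, <- pow_add; apply HM.
  - replace (M * / (1 - q) * q ^ S K) with (M * q ^ S K * / (1 - q)) by ring.
    apply (is_series_scal_l (V := R_NormedModule) (M * q ^ S K)), is_series_geom.
    rewrite Rabs_pos_eq; lra.
Qed.

(** Truncation raises the bound [B] by a geometric tail independent of [t]. The polynomial
    inequality applies to each truncation, and the tail vanishes in the limit. *)
Lemma trig_series_wiener (d : nat -> C) (B M q : R) (N : nat) :
  0 <= q < 1 -> (forall n, Cmod (d n) <= M * q ^ n) ->
  (forall t, exists s,
     is_series (fun n => d n * cis (INR n * t))%C s /\ Cmod s <= B) -> (0 < N)%nat ->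
  Cmod (d N) + 2 * Cmod (d O) ^ 2 <= B * (1 + Cmod (d O) ^ 2).
Proof.
  intros Hq HM HG HN.
  set (g := 1 + Cmod (d O) ^ 2).
  assert (HK : forall k, Cmod (d N) + 2 * Cmod (d O) ^ 2
    <= B * g + M * / (1 - q) * g * q ^ (k + S N)).
  { intro k.
    replace (B * g + M * / (1 - q) * g * q ^ (k + S N))
      with ((B + M * / (1 - q) * q ^ S (k + N)) * g)
      by (rewrite Nat.add_succ_r; ring).
    apply (trig_poly_wiener d (S (k + N)) N); [lia|].
    intro t; destruct (HG t) as (s & Hs & HB).
    replace (trig_poly d (S (k + N)) t)
      with (s + - (s - Csum (fun n => d n * cis (INR n * t)) (S (k + N))))%C
      by (unfold trig_poly; ring).
    eapply Rle_trans; [apply Cmod_triangle|].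
    rewrite Cmod_opp; apply Rplus_le_compat; [exact HB|].
    apply Cmod_tail_geom_le; [exact Hq|exact Hs|].
    intro n; rewrite Cmod_mult, Cmod_cis, Rmult_1_r; apply HM. }
  refine (is_lim_seq_le (fun _ => Cmod (d N) + 2 * Cmod (d O) ^ 2) _
    (Cmod (d N) + 2 * Cmod (d O) ^ 2) (B * g) HK (is_lim_seq_const _) _).
  replace (Finite (B * g)) with (Finite (B * g + M * / (1 - q) * g * 0))
    by (f_equal; ring).
  apply is_lim_seq_plus'; [apply is_lim_seq_const|].
  apply (is_lim_seq_scal_l _ (M * / (1 - q) * g) 0).
  apply (is_lim_seq_incr_n (fun n => q ^ n)), is_lim_seq_geom.
  rewrite Rabs_pos_eq; lra.
Qed.

Lemma le_at_1_of_continuous (phi : R -> R) (c : R) :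
  continuous phi 1 -> (forall x, 0 < x < 1 -> phi x <= c) -> phi 1 <= c.
Proof.
  intros Hc H.
  assert (Hl : is_lim_seq (fun n => 1 - / 2 * (/ 2) ^ n) 1).
  { replace (Finite 1) with (Finite (1 - / 2 * 0)) by (f_equal; ring).
    apply is_lim_seq_minus'; [apply is_lim_seq_const|].
    apply (is_lim_seq_scal_l _ (/ 2) 0), is_lim_seq_geom.
    rewrite Rabs_pos_eq; lra. }
  refine (is_lim_seq_le (fun n => phi (1 - / 2 * (/ 2) ^ n)) (fun _ => c) (phi 1) c
    _ _ (is_lim_seq_const _)).
  - intro n; apply H.
    assert (0 < (/ 2) ^ n <= 1); [|lra].
    split; [apply pow_lt; lra|].
    rewrite <- (pow1 n); apply pow_incr; lra.
  - exact (filterlim_comp _ _ _ _ _ _ _ _ Hl Hc).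
Qed.

(** Convergence at the larger radius [y = (1 + x) / 2] bounds the terms there; returning to [x]
    gains the ratio [(x / y)^p]. *)
Lemma lacunary_terms_geom (p m : nat) (a : nat -> C) (f : C -> C) (x : R) :
  (0 < p)%nat -> lacunary_expansion p m a f -> 0 < x < 1 ->
  exists M q, 0 <= q < 1 /\ forall n, Cmod (a (n * p + m)%nat) * x ^ (n * p) <= M * q ^ n.
Proof.
  intros Hp Ha Hx.
  set (y := (1 + x) / 2).
  assert (Hy : 0 < y < 1) by (unfold y; lra).
  destruct (Ha (RtoC y)) as (s & Hs & _).
  { rewrite Cmod_R, Rabs_pos_eq; lra. }
  destruct (is_series_terms_bounded _ _ Hs) as [M HM].
  assert (Hxy : 0 <= x / y < 1).
  { split; [apply Rlt_le, Rdiv_lt_0_compat; lra|].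
    apply Rmult_lt_reg_r with y; [lra|].
    unfold Rdiv; rewrite Rmult_assoc, Rinv_l by lra; unfold y; lra. }
  exists M, ((x / y) ^ p); split.
  - split; [apply pow_le; lra|].
    destruct p as [|p']; [lia|].
    apply pow_lt_1_compat; [exact Hxy|lia].
  - intro n; specialize (HM n).
    rewrite Cmod_mult, Cmod_pow, Cmod_R, Rabs_pos_eq in HM by lra.
    rewrite <- pow_mult, (Nat.mul_comm p n).
    replace (x ^ (n * p)) with (y ^ (n * p) * (x / y) ^ (n * p)).
    + rewrite <- Rmult_assoc; apply Rmult_le_compat_r; [apply pow_le; lra|exact HM].
    + rewrite <- Rpow_mult_distr; f_equal; field; lra.
Qed.

(** On the circle of radius [x], the series for [f / z^m] is bounded by [/ x^m]. The statement is
    multiplied through by [x^m]. *)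
Lemma lacunary_wiener_circle (p m : nat) (a : nat -> C) (f : C -> C)
    (x : R) (N : nat) :
  (0 < p)%nat -> class_B f -> lacunary_expansion p m a f -> 0 < x < 1 -> (0 < N)%nat ->
  x ^ m * (Cmod (a (N * p + m)%nat) * x ^ (N * p) + 2 * Cmod (a m) ^ 2)
    <= 1 + Cmod (a m) ^ 2.
Proof.
  intros Hp Hf Ha Hx HN.
  set (b := fun n => a (n * p + m)%nat).
  destruct (lacunary_terms_geom p m a f x Hp Ha Hx) as (M & q & Hq & HM).
  assert (Hxm : 0 < x ^ m) by (apply pow_lt; lra).
  assert (HpR : INR p <> 0) by (apply not_0_INR; lia).
  set (d := fun n => (b n * RtoC (x ^ (n * p)))%C).
  assert (Hd : forall n, Cmod (d n) = Cmod (b n) * x ^ (n * p)).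
  { intro n; unfold d; rewrite Cmod_mult, Cmod_R, Rabs_pos_eq; [reflexivity|].
    apply pow_le; lra. }
  assert (HG : forall t, exists s,
    is_series (fun n => d n * cis (INR n * t))%C s /\ Cmod s <= / x ^ m).
  { intro t.
    (* Dividing the angle by [p] turns [z^(n p)] into [x^(n p) cis (n t)], so the lacunary series
       becomes an ordinary trigonometric series in [t]. *)
    set (z := (RtoC x * cis (t / INR p))%C).
    assert (Hz : Cmod z = x).
    { unfold z; rewrite Cmod_mult, Cmod_cis, Cmod_R, Rabs_pos_eq; lra. }
    destruct (Ha z) as (s & Hs & Hfs); [lra|].
    exists s; split.
    - eapply is_series_ext; [|exact Hs].
      intro n; unfold d, z, b; cbv beta.
      rewrite Cpow_mult_l, <- RtoC_pow, Cpow_cis, mult_INR.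
      replace (INR n * INR p * (t / INR p)) with (INR n * t) by (field; exact HpR).
      apply Cmult_assoc.
    - destruct (Hf z) as [_ H1]; [lra|].
      rewrite Hfs, Cmod_mult, Cmod_pow, Hz in H1.
      apply Rmult_le_reg_l with (x ^ m); [exact Hxm|].
      rewrite Rinv_r; lra. }
  assert (H := trig_series_wiener d (/ x ^ m) M q N Hq).
  rewrite (Hd 0%nat), (Hd N) in H; simpl (0 * p)%nat in H; rewrite pow_O, Rmult_1_r in H.
  apply Rmult_le_reg_l with (/ x ^ m); [apply Rinv_0_lt_compat, Hxm|].
  rewrite <- Rmult_assoc, Rinv_l, Rmult_1_l by lra.
  apply H; [intro n; rewrite Hd; apply HM|exact HG|exact HN].
Qed.

(** The circle inequality is polynomial in [x], so it passes to [x = 1], where it rearranges to the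
    claim. *)
Lemma lacunary_wiener (p m : nat) (a : nat -> C) (f : C -> C) (N : nat) :
  (0 < p)%nat -> class_B f -> lacunary_expansion p m a f -> (0 < N)%nat ->
  Cmod (a (N * p + m)%nat) <= 1 - Cmod (a m) ^ 2.
Proof.
  intros Hp Hf Ha HN.
  assert (H := le_at_1_of_continuous
    (fun x => x ^ m * (Cmod (a (N * p + m)%nat) * x ^ (N * p) + 2 * Cmod (a m) ^ 2))
    (1 + Cmod (a m) ^ 2)).
  cbv beta in H; rewrite !pow1 in H.
  assert (1 * (Cmod (a (N * p + m)%nat) * 1 + 2 * Cmod (a m) ^ 2) <= 1 + Cmod (a m) ^ 2); [|lra].
  apply H.
  - apply (ex_derive_continuous (V := R_NormedModule)); auto_derive; exact I.
  - intros x Hx; apply (lacunary_wiener_circle p m a f); assumption.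
Qed.

Lemma lacunary_Cmod_le (p m : nat) (a : nat -> C) (f : C -> C)
    (z : C) (T : R) :
  lacunary_expansion p m a f -> Cmod z < 1 ->
  is_series (fun n => Cmod (a (n * p + m)%nat) * Cmod z ^ (n * p)) T ->
  Cmod (f z) <= Cmod z ^ m * T.
Proof.
  intros Ha Hz HT.
  destruct (Ha z Hz) as (s & Hs & ->).
  rewrite Cmod_mult, Cmod_pow; apply Rmult_le_compat_l; [apply pow_le, Cmod_ge_0|].
  apply (Cmod_is_series_le _ _ _ _ Hs) with (2 := HT).
  intro n; rewrite Cmod_mult, Cmod_pow; apply Rle_refl.
Qed.


(** * The alternating refined sum *)

Lemma is_series_le (u v : nat -> R) (l l' : R) :
  is_series u l -> is_series v l' -> (forall n, u n <= v n) -> l <= l'.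
Proof.
  intros Hu Hv H.
  refine (is_lim_seq_le (sum_n u) (sum_n v) l l' _ Hu Hv).
  intro n; apply sum_n_m_le, H.
Qed.

Lemma is_series_geom_S (q : R) : Rabs q < 1 ->
  is_series (fun n => q ^ S n) (q / (1 - q)).
Proof.
  intro Hq; apply (is_series_scal_l (V := R_NormedModule) q), is_series_geom, Hq.
Qed.

Lemma ex_series_geom_le (u : nat -> R) (c q : R) : Rabs q < 1 ->
  (forall n, Rabs (u n) <= c * q ^ S n) -> ex_series u.
Proof.
  intros Hq Hu.
  apply (ex_series_le (V := R_CompleteNormedModule) u (fun n => c * q ^ S n) Hu).
  apply (ex_series_scal_l (V := R_NormedModule) c).
  eexists; apply is_series_geom_S, Hq.
Qed.

(* In [S + U] the odd terms cancel, so its first-order part at [A 0 = 1] is only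
   [4 (1 - A 0) x^2 / (1 - x^2)]. *)
Lemma alternating_refined_bounds (A : nat -> R) (x : R) :
  (forall n, 0 <= A n) -> (forall n, A (S n) <= 1 - A O ^ 2) ->
  0 <= x -> x ^ 2 + 2 * x <= 1 ->
  exists S0 U W,
    is_series (fun n => A n * x ^ n) S0 /\
    is_series (fun n => (-1) ^ S n * A (S n) * x ^ S n) U /\
    is_series (fun n => A (S n) ^ 2 * (x ^ 2) ^ S n) W /\
    S0 + (U + (/ (1 + A O) + x ^ 2 / (1 - x ^ 2)) * W) <= 1 /\
    -1 <= U + (/ (1 + A O) + x ^ 2 / (1 - x ^ 2)) * W.
Proof.
  intros HA0 HA Hx Hx2.
  set (al := A O) in *.
  assert (Hal : 0 <= al) by apply HA0.
  set (e := 1 - al ^ 2) in *.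
  assert (He : 0 <= e) by (generalize (HA O) (HA0 1%nat); lra).
  assert (Hal1 : al <= 1) by (unfold e in He; nra).
  (* The hypothesis says [x <= sqrt 2 - 1], about 0.4142. The rational bounds on [x^2] and on [q]
     below follow from this one. *)
  assert (Hx1 : x <= 415 / 1000) by nra.
  assert (Hq1 : Rabs x < 1) by (rewrite Rabs_pos_eq; lra).
  assert (Hq2 : Rabs (- x) < 1) by (rewrite Rabs_Ropp; exact Hq1).
  assert (Hxx : 0 <= x ^ 2 <= 173 / 1000) by nra.
  assert (Hq3 : Rabs (x ^ 2) < 1) by (rewrite Rabs_pos_eq; lra).
  assert (Hsgn : forall k, (-1) ^ k * x ^ k = (- x) ^ k).
  { intro k; rewrite <- Rpow_mult_distr; f_equal; ring. }
  assert (Hpm : forall k, (- x) ^ k = x ^ k \/ (- x) ^ k = - x ^ k).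
  { intro k; rewrite <- Hsgn.
    destruct (Nat.Even_or_Odd k) as [[j ->]|[j ->]].
    - left; rewrite pow_1_even; ring.
    - right; rewrite Nat.add_1_r, pow_1_odd; ring. }
  assert (Hxk : forall k, 0 <= x ^ k) by (intro; apply pow_le, Hx).
  assert (HV : ex_series (fun n => A (S n) * x ^ S n)).
  { apply (ex_series_geom_le _ e x Hq1); intro n.
    rewrite Rabs_pos_eq by (apply Rmult_le_pos; auto).
    apply Rmult_le_compat_r; auto. }
  assert (HU : ex_series (fun n => (-1) ^ S n * A (S n) * x ^ S n)).
  { apply (ex_series_geom_le _ e x Hq1); intro n.
    rewrite !Rabs_mult, pow_1_abs, Rmult_1_l, !Rabs_pos_eq by auto.
    apply Rmult_le_compat_r; auto. }
  assert (HWt : forall n, 0 <= A (S n) ^ 2 * (x ^ 2) ^ S n <= e ^ 2 * (x ^ 2) ^ S n).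
  { intro n.
    assert (0 <= (x ^ 2) ^ S n) by (apply pow_le; lra).
    split; [apply Rmult_le_pos; [apply pow2_ge_0|assumption]|].
    apply Rmult_le_compat_r; [assumption|]. apply pow_incr; auto. }
  assert (HW : ex_series (fun n => A (S n) ^ 2 * (x ^ 2) ^ S n)).
  { apply (ex_series_geom_le _ (e ^ 2) (x ^ 2) Hq3); intro n.
    rewrite Rabs_pos_eq; apply HWt. }
  destruct (HV : exists l : R, _) as [V HV'].
  destruct (HU : exists l : R, _) as [U HU'].
  destruct (HW : exists l : R, _) as [W HW'].
  clear HV HU HW; rename HV' into HV, HU' into HU, HW' into HW.
  set (q := x ^ 2 / (1 - x ^ 2)).
  assert (Hq : 0 <= q <= 21 / 100).
  { unfold q; split.
    - apply Rmult_le_pos; [lra|apply Rlt_le, Rinv_0_lt_compat; lra].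
    - apply Rmult_le_reg_r with (1 - x ^ 2); [lra|].
      unfold Rdiv; rewrite Rmult_assoc, Rinv_l by lra; lra. }
  (* Odd terms of [V] and [U] cancel and even ones double; the majorant [x^n + (-x)^n] sums to
     [2 q]. *)
  assert (HVU : V + U <= e * (2 * q)).
  { replace (e * (2 * q)) with (e * (x / (1 - x) + - x / (1 - - x)))
      by (unfold q; field; nra).
    apply (is_series_le _ _ _ _ (is_series_plus _ _ _ _ HV HU)
      (is_series_scal_l e _ _
        (is_series_plus _ _ _ _ (is_series_geom_S x Hq1) (is_series_geom_S (- x) Hq2)))).
    intro n.
    change (A (S n) * x ^ S n + (-1) ^ S n * A (S n) * x ^ S n
      <= e * (x ^ S n + (- x) ^ S n)).
    replace ((-1) ^ S n * A (S n) * x ^ S n) with (A (S n) * (- x) ^ S n)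
      by (rewrite <- Hsgn; ring).
    rewrite <- Rmult_plus_distr_l; apply Rmult_le_compat_r; [|apply HA].
    destruct (Hpm (S n)) as [-> | ->]; generalize (Hxk (S n)); lra. }
  assert (HWle : 0 <= W <= e ^ 2 * q).
  { split.
    - refine (is_series_le (fun _ => 0) _ 0 W _ HW (fun n => proj1 (HWt n))).
      apply (is_series_ext (fun n => 0 * x ^ S n)); [intro; apply Rmult_0_l|].
      assert (H0 := is_series_scal_l (V := R_NormedModule) 0 _ _ (is_series_geom_S x Hq1)).
      change (scal 0 (x / (1 - x))) with (0 * (x / (1 - x))) in H0.
      rewrite Rmult_0_l in H0; exact H0.
    - apply (is_series_le _ _ _ _ HW
        (is_series_scal_l (e ^ 2) _ _ (is_series_geom_S (x ^ 2) Hq3))), HWt. }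
  (* Only odd indices contribute positively to [-U]; half of [x^n - (-x)^n] selects them. *)
  assert (HUge : - U <= e * (x / (1 - x ^ 2))).
  { replace (e * (x / (1 - x ^ 2))) with (e / 2 * (x / (1 - x) + - (- x / (1 - - x))))
      by (field; nra).
    apply (is_series_le _ _ _ _ (is_series_opp _ _ HU)
      (is_series_scal_l (e / 2) _ _
        (is_series_plus _ _ _ _ (is_series_geom_S x Hq1)
           (is_series_opp _ _ (is_series_geom_S (- x) Hq2))))).
    intro n.
    change (- ((-1) ^ S n * A (S n) * x ^ S n)
      <= e / 2 * (x ^ S n + - (- x) ^ S n)).
    replace ((-1) ^ S n * A (S n) * x ^ S n) with (A (S n) * (- x) ^ S n)
      by (rewrite <- Hsgn; ring).
    assert (H1 := Hxk (S n)); assert (H2 := HA n); assert (H3 := HA0 (S n)).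
    destruct (Hpm (S n)) as [-> | ->]; nra. }
  set (c := / (1 + al) + q).
  assert (Hc : 0 <= c).
  { unfold c; assert (0 < / (1 + al)) by (apply Rinv_0_lt_compat; lra); lra. }
  assert (HcW : 0 <= c * W <= c * (e ^ 2 * q)).
  { split; [apply Rmult_le_pos|apply Rmult_le_compat_l]; lra. }
  exists (V + al), U, W; split; [|split; [exact HU|split; [exact HW|split]]].
  - apply is_series_decr_1.
    change (is_series (fun k => A (S k) * x ^ S k) (V + al + - (A O * x ^ O))).
    replace (V + al + - (A O * x ^ O)) with V by (unfold al; simpl; ring).
    exact HV.
  (* The goal reduces to [2 e q + c e^2 q <= 1 - al]. Since [e = (1 - al) (1 + al)], the factor
     [1 - al] comes out of the left side, leaving [Hs], which follows from [q <= 21 / 100]. *)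
  - assert (Hce : c * (e ^ 2 * q) = (1 - al) * (e * q + q * (1 + al) * (e * q))).
    { unfold c, e; field; lra. }
    assert (Heq : e * q = (1 - al) * ((1 + al) * q)) by (unfold e; ring).
    assert (Hs : (1 + al) * q * (2 + (1 - al) * (1 + q * (1 + al))) <= 1).
    { assert (0 <= (1 + al) * q <= 21 / 100 * (1 + al)) by nra.
      assert (q * (1 + al) <= 42 / 100) by nra.
      assert ((1 - al) * (1 + q * (1 + al)) <= (1 - al) * (142 / 100)) by nra.
      nra. }
    assert (H1 := Rmult_le_compat_l (1 - al) _ _ ltac:(lra) Hs).
    nra.
  (* The [W] part is nonnegative, so only [-U <= 1] matters; it follows from [e <= 1] and
     [x <= 1 - x^2]. *)
  - assert (H1 : x / (1 - x ^ 2) <= 1).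
    { apply Rmult_le_reg_r with (1 - x ^ 2); [lra|].
      unfold Rdiv; rewrite Rmult_assoc, Rinv_l by lra; lra. }
    assert (e <= 1) by (unfold e; nra).
    assert (0 <= x / (1 - x ^ 2)).
    { apply Rmult_le_pos; [lra|apply Rlt_le, Rinv_0_lt_compat; lra]. }
    nra.
Qed.

(** * The radius *)

(** The root is the supremum of the [t] for which [P] is positive on all of [[0, t]], which makes it
    the least one. By continuity, a negative value there would spread to the left, where [P] is
    positive, and a positive value would let the interval grow. *)
Lemma least_positive_root (P : R -> R) :
  (forall x, continuous P x) -> 0 < P 0 -> P 1 < 0 ->
  exists rho, 0 < rho < 1 /\ P rho = 0 /\ forall s, 0 <= s < rho -> 0 < P s.
Proof.
  intros HP H0 H1.
  set (E := fun t => 0 <= t <= 1 /\ forall s, 0 <= s <= t -> 0 < P s).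
  assert (HE0 : E 0).
  { split; [lra|]. intros s Hs; replace s with 0 by lra; exact H0. }
  destruct (completeness E) as [rho [Hub Hlub]].
  { exists 1; intros t [Ht _]; lra. }
  { exists 0; exact HE0. }
  assert (Hrho0 : 0 <= rho) by exact (Hub 0 HE0).
  assert (Hrho1 : rho <= 1) by (apply Hlub; intros t [Ht _]; lra).
  assert (Hbelow : forall s, 0 <= s < rho -> 0 < P s).
  { intros s Hs; apply Rnot_le_lt; intro HPs.
    apply (Rlt_not_le rho s); [lra|].
    apply Hlub; intros t [Ht Hpos]; apply Rnot_lt_le; intro Hst.
    apply (Rlt_not_le (P s) 0); [apply Hpos; lra|exact HPs]. }
  assert (HPrho : P rho = 0).
  { destruct (Rtotal_order (P rho) 0) as [Hneg|[Hz|Hpos]]; [exfalso|exact Hz|exfalso].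
    - destruct (HP rho _ (open_lt 0 (P rho) Hneg)) as [d Hd].
      assert (Hd0 := cond_pos d).
      assert (rho <> 0) by (intros ->; lra).
      set (s := Rmax 0 (rho - d / 2)).
      assert (Hs : 0 <= s < rho /\ rho - d / 2 <= s).
      { unfold s; generalize (Rmax_l 0 (rho - d / 2)) (Rmax_r 0 (rho - d / 2)).
        intros; repeat split; try apply Rmax_lub_lt; lra. }
      assert (P s < 0); [|generalize (Hbelow s (proj1 Hs)); lra].
      apply Hd; change (Rabs (s - rho) < d); apply Rabs_def1; lra.
    - destruct (HP rho _ (open_gt 0 (P rho) Hpos)) as [d Hd].
      assert (Hd0 := cond_pos d).
      assert (rho <> 1) by (intros ->; lra).
      set (t := Rmin 1 (rho + d / 2)).
      assert (Ht : rho < t <= 1 /\ t <= rho + d / 2).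
      { unfold t; generalize (Rmin_l 1 (rho + d / 2)) (Rmin_r 1 (rho + d / 2)).
        intros; repeat split; try apply Rmin_glb_lt; lra. }
      assert (E t); [|assert (t <= rho) by (apply Hub; assumption); lra].
      split; [lra|]. intros s Hs.
      destruct (Rlt_le_dec s rho) as [Hsr|Hsr]; [apply Hbelow; lra|].
      apply Hd; change (Rabs (s - rho) < d); apply Rabs_def1; lra. }
  exists rho; repeat split; try assumption.
  - destruct Hrho0 as [|<-]; [assumption|lra].
  - destruct Hrho1 as [| ->]; [assumption|lra].
Qed.

(* Multiplying by [r^m], the inequality reads [x - x^3 <= r^m (1 + x)^2 (1 - 2 x)]
   with [x = r^p]; then [r^m <= 1] lets the factor [1 + x] cancel. *)
Lemma radius_power_bound (p m : nat) (r : R) : (m < p)%nat -> 0 <= r < 1 ->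
  0 <= r ^ (3 * p - m) - 2 * r ^ (3 * p) - 3 * r ^ (2 * p) - r ^ (p - m) + 1 ->
  (r ^ p) ^ 2 + 2 * r ^ p <= 1.
Proof.
  intros Hm Hr H.
  assert (Hx1 : 0 <= r ^ p < 1).
  { split; [apply pow_le; lra|apply pow_lt_1_compat; [lra|lia]]. }
  assert (Hrm : 0 <= r ^ m <= 1).
  { split; [apply pow_le; lra|]. rewrite <- (pow1 m); apply pow_incr; lra. }
  assert (E3 : r ^ (3 * p - m) * r ^ m = (r ^ p) ^ 3).
  { rewrite <- pow_add, <- pow_mult; f_equal; lia. }
  assert (E1 : r ^ (p - m) * r ^ m = r ^ p).
  { rewrite <- pow_add; f_equal; lia. }
  rewrite (Nat.mul_comm 3 p), (Nat.mul_comm 2 p), (pow_mult r p 3), (pow_mult r p 2) in H.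
  rewrite (Nat.mul_comm p 3) in H.
  assert (H' := Rmult_le_compat_r (r ^ m) _ _ (proj1 Hrm) H).
  set (x := r ^ p) in *; set (y := r ^ m) in *.
  assert (K : x - x ^ 3 <= y * (1 - 3 * x ^ 2 - 2 * x ^ 3)) by lra.
  assert (K1 : 0 <= x - x ^ 3) by nra.
  assert (K2 : x - x ^ 3 <= 1 - 3 * x ^ 2 - 2 * x ^ 3).
  (* A nonnegative bracket allows [y] to be replaced by 1. A negative one would force [x = 0], where
     the bracket equals 1. *)
  { destruct (Rle_lt_dec 0 (1 - 3 * x ^ 2 - 2 * x ^ 3)); nra. }
  apply Rmult_le_reg_l with (1 + x); [lra|]. lra.
Qed.

(** * Assembly of the coefficient, series and radius bounds *)

Theorem theorem6 :
  forall (m p : nat), Nat.Even m -> Nat.Odd p -> (m <= p)%nat ->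
  exists r_pm : R,
    is_min_pos_root (radius_eq p m) r_pm /\
    forall (f : C -> C) (a : nat -> C),
      class_B f -> lacunary_expansion p m a f ->
      forall (z : C) (r : R), Cmod z = r -> r <= r_pm ->
        Rabs (Cmod (f z) + E_fm p m a r) <= 1.
Proof.
  intros m p Hm Hp Hmp.
  (* Strictness makes [p - m] positive, so the radius polynomial equals 1 at 0; at 1 it equals
     -4. *)
  assert (Hlt : (m < p)%nat) by (destruct Hm, Hp; lia).
  destruct (least_positive_root
    (fun r => r ^ (3 * p - m) - 2 * r ^ (3 * p) - 3 * r ^ (2 * p) - r ^ (p - m) + 1))
    as (rho & Hrho & Hroot & Hbelow).
  - intro x; apply (ex_derive_continuous (V := R_NormedModule)); auto_derive; exact I.
  - rewrite !pow_i by lia; lra.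
  - rewrite !pow1; lra.
  - exists rho; split.
    { split; [lra|split; [exact Hroot|]].
      intros s Hs HPs; apply Rnot_lt_le; intro Hsr.
      specialize (Hbelow s (conj (Rlt_le _ _ Hs) Hsr)); unfold radius_eq in HPs; lra. }
    intros f a Hf Ha z r Hz Hr.
    assert (Hr0 : 0 <= r) by (rewrite <- Hz; apply Cmod_ge_0).
    assert (Hx : (r ^ p) ^ 2 + 2 * r ^ p <= 1).
    { apply (radius_power_bound p m); [exact Hlt|lra|].
      destruct Hr as [Hr| ->]; [apply Rlt_le, Hbelow; lra|rewrite Hroot; lra]. }
    destruct (alternating_refined_bounds (fun n => Cmod (a (n * p + m)%nat)) (r ^ p))
      as (S0 & U & W & HS & HU & HW & Hup & Hlow).
    { intro; apply Cmod_ge_0. }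
    { intro n; apply (lacunary_wiener p m a f); auto; lia. }
    { apply pow_le, Hr0. }
    { exact Hx. }
    (* Parity turns [(-1)^(n p + m)] into [(-1)^n] and the outer [(-1)^m] into 1. *)
    assert (HE : E_fm p m a r
      = r ^ m * (U + (/ (1 + Cmod (a m)) + (r ^ p) ^ 2 / (1 - (r ^ p) ^ 2)) * W)).
    { assert (Hm1 : (-1) ^ m = 1) by (destruct Hm as [j ->]; apply pow_1_even).
      assert (Hp1 : (-1) ^ p = -1)
        by (destruct Hp as [j ->]; rewrite Nat.add_1_r; apply pow_1_odd).
      unfold E_fm, Series1; rewrite Hm1.
      rewrite (Series_ext _ (fun n => (-1) ^ S n * Cmod (a (S n * p + m)%nat) * (r ^ p) ^ S n)).
      2:{ intro n; rewrite pow_add, Hm1, (Nat.mul_comm (S n) p), !pow_mult, Hp1; ring. }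
      rewrite (Series_ext (fun n => Cmod (a (S n * p + m)%nat) ^ 2 * _)
        (fun n => Cmod (a (S n * p + m)%nat) ^ 2 * ((r ^ p) ^ 2) ^ S n)).
      2:{ intro n; rewrite <- !pow_mult; do 2 f_equal; ring. }
      rewrite (is_series_unique _ _ HU), (is_series_unique _ _ HW).
      rewrite (Nat.mul_comm 2 p), pow_mult; ring. }
    assert (HfS : Cmod (f z) <= r ^ m * S0).
    { rewrite <- Hz; apply (lacunary_Cmod_le p m a f); [exact Ha|lra|].
      eapply is_series_ext; [|exact HS].
      intro n; rewrite Hz, (Nat.mul_comm n p), pow_mult; reflexivity. }
    assert (Hrm : 0 <= r ^ m <= 1).
    { split; [apply pow_le, Hr0|]. rewrite <- (pow1 m); apply pow_incr; lra. }
    rewrite HE; simpl (0 * p + m)%nat in Hup, Hlow.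
    set (E := U + _) in *.
    assert (Hf0 := Cmod_ge_0 (f z)).
    (* Above: [r^m (S0 + E) <= r^m <= 1]. Below: [|f z| >= 0] and [r^m E >= - r^m >= -1]. *)
    apply Rabs_le; split; nra.
Qed.
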